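(* Let $X$ be a finite alphabet with at least two letters and $k\ge2$, and let $\mathcal{B}$ be either the class $\mathcal R$ of regular $\omega$-languages or the class $\mathcal A$ of aperiodic $\omega$-languages over $X$. Then for every $F\in\mathcal{F}_{\mathcal{T}_k}$ we have $\mathcal{B}\mathbf{\Sigma}(F)=\mathcal{B}_k\cap\mathbf{\Sigma}(F)$.
   Context: Regular and aperiodic $\omega$-languages: recognised by deterministic Muller acceptors (resp. with aperiodic automaton, i.e. $f(q,u^n)=q$, $u\neq\varepsilon$, $n>0$ imply $f(q,u)=q$). $\bar k=\{0,\dots,k-1\}$; $\mathcal B_k$ is the set of functions $X^\omega\to\bar k$ all of whose preimages $A^{-1}(i)$ lie in $\mathcal B$. Trees/forests: a finite nonempty poset whose lower cones are chains is a forest; a tree has a least element. We represent a forest as a finite set $F\subseteq\omega^+$ of nonempty finite strings closed under nonempty prefixes, ordered by the prefix relation (roots are strings of length 1, successors of $\tau$ are the $\tau i\in F$), and a tree as a finite $V\subseteq\omega^*$ closed under prefixes (root $\varepsilon$). $\mathcal T_k$ is the set of trees labeled by $\bar k$; $\mathcal F_{\mathcal T_k}$ the set of forests $(F,c)$ with each label $c(\tau)=(V,v)\in\mathcal T_k$. A 2-base in a set $S$ is a pair $\mathcal L=(\mathcal L_0,\mathcal L_1)$ of families of subsets of $S$ closed under finite unions and intersections and containing $\emptyset,S$, with each set of $\mathcal L_0$ and its complement in $\mathcal L_1$. For a 1-base $\mathcal L'$ in a set $S'$ and a forest (or tree) $W$ labeled in $\bar k$ or $\mathcal T_k$, a $W$-family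 over $\mathcal L'$ is $\{U_\tau\}_{\tau\in W}$ with $U_\tau\in\mathcal L'$, $U_{\tau i}\subseteq U_\tau$, $\bigcup_\tau U_\tau=S'$; write $\tilde U_\tau=U_\tau\setminus\bigcup_{\tau i\in W}U_{\tau i}$. For $(F,c)\in\mathcal F_{\mathcal T_k}$, an $F$-family over $\mathcal L$ consists of an $F$-family $\{U_\tau\}$ over $\mathcal L_0$ and, for each $\tau\in F$ with $c(\tau)=(V,v)$, a $V$-family $\{U_{\tau\sigma}\}_{\sigma\in V}$ over the 1-base $\{\tilde U_\tau\cap B: B\in\mathcal L_1\}$ in $\tilde U_\tau$; it determines $A:S\to\bar k$ if $A(x)=v(\sigma)$ whenever $\tau\in F$, $c(\tau)=(V,v)$, $\sigma\in V$ and $x\in\tilde U_{\tau\sigma}=U_{\tau\sigma}\setminus\bigcup_{\sigma i\in V}U_{\tau\sigma i}$. $\mathcal L(F)$ is the set of $k$-partitions of $S$ determined by some $F$-family over $\mathcal L$. $\mathbf\Sigma=(\mathbf\Sigma^0_1,\mathbf\Sigma^0_2)$ is the 2-base in $X^\omega$ of open sets and countable unions of closed sets (Cantor topology); $\mathbf\Sigma(F)$ is its level. $\mathcal B\mathbf\Sigma$ is the 2-base $(\mathcal B\cap\mathbf\Sigma^0_1,\mathcal B\cap\mathbf\Sigma^0_2)$ and $\mathcal B\mathbf\Sigma(F)$ its level. *)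

(* Defs.v *)
From mathcomp Require Import all_boot.
Set Implicit Arguments. Unset Strict Implicit. Unset Printing Implicit Defensive.

Section Automata.
Variable X : finType.

Fixpoint run (Q : Type) (f : Q -> X -> Q) (q0 : Q) (x : nat -> X) (n : nat) : Q :=
  match n with 0 => q0 | n'.+1 => f (run f q0 x n') (x n') end.

Definition ext (Q : Type) (f : Q -> X -> Q) (q : Q) (u : seq X) : Q := foldl f q u.

Definition inf_often (Q : Type) (r : nat -> Q) (q : Q) : Prop :=
  forall m, exists n, m <= n /\ r n = q.

Definition muller_accepts (Q : finType) (f : Q -> X -> Q) (q0 : Q)
    (T : seq {set Q}) (x : nat -> X) : Prop :=
  exists2 S, S \in T & forall q, q \in S <-> inf_often (run f q0 x) q.

Definition aperiodic_automaton (Q : finType) (f : Q -> X -> Q) : Prop :=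
  forall (q : Q) (u : seq X) (n : nat), u != [::] -> 0 < n ->
    ext f q (flatten (nseq n u)) = q -> ext f q u = q.

Definition regular (L : (nat -> X) -> Prop) : Prop :=
  exists (Q : finType) (f : Q -> X -> Q) (q0 : Q) (T : seq {set Q}),
    forall x, L x <-> muller_accepts f q0 T x.

Definition aperiodic (L : (nat -> X) -> Prop) : Prop :=
  exists (Q : finType) (f : Q -> X -> Q) (q0 : Q) (T : seq {set Q}),
    aperiodic_automaton f /\ forall x, L x <-> muller_accepts f q0 T x.

Definition cantor_open (U : (nat -> X) -> Prop) : Prop :=
  forall x, U x -> exists n, forall y, (forall i, i < n -> y i = x i) -> U y.

Definition cantor_closed (C : (nat -> X) -> Prop) : Prop :=
  cantor_open (fun x => ~ C x).

Definition sigma02 (U : (nat -> X) -> Prop) : Prop :=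
  exists C : nat -> (nat -> X) -> Prop,
    (forall n, cantor_closed (C n)) /\ forall x, U x <-> exists n, C n x.

Definition in_Bk (B : ((nat -> X) -> Prop) -> Prop) (k : nat)
    (A : (nat -> X) -> 'I_k) : Prop :=
  forall i : 'I_k, B (fun x => A x = i).

End Automata.

(* Trees and forests, as finite sets of strings of naturals *)
Definition is_forest (F : seq (seq nat)) : Prop :=
  [/\ F != [::], (forall s, s \in F -> s != [::]) &
      (forall s n, s \in F -> 0 < n -> take n s \in F)].

Definition is_tree (V : seq (seq nat)) : Prop :=
  V != [::] /\ (forall s n, s \in V -> take n s \in V).

(* a tree labeled by 'I_k (labels outside the tree are irrelevant) *)
Record ltree (k : nat) := LTree { lt_V : seq (seq nat); lt_v : seq nat -> 'I_k }.

Definition forest_of_trees (k : nat) (F : seq (seq nat)) (c : seq nat -> ltree k) : Prop :=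
  is_forest F /\ forall t, t \in F -> is_tree (lt_V (c t)).

Section Levels.
Variable S : Type.

Definition family (Amb : S -> Prop) (L : (S -> Prop) -> Prop)
    (W : seq (seq nat)) (U : seq nat -> S -> Prop) : Prop :=
  [/\ (forall t, t \in W -> L (U t)),
      (forall t i x, t \in W -> rcons t i \in W -> U (rcons t i) x -> U t x) &
      (forall x, Amb x <-> exists t, t \in W /\ U t x)].

Definition tilde (W : seq (seq nat)) (U : seq nat -> S -> Prop) (t : seq nat) (x : S) : Prop :=
  U t x /\ ~ (exists i, rcons t i \in W /\ U (rcons t i) x).

Definition restr_base (L1 : (S -> Prop) -> Prop) (Amb : S -> Prop) (Y : S -> Prop) : Prop :=
  exists B, L1 B /\ forall x, Y x <-> (Amb x /\ B x).

Definition level (L0 L1 : (S -> Prop) -> Prop) (k : nat)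
    (F : seq (seq nat)) (c : seq nat -> ltree k) (A : S -> 'I_k) : Prop :=
  exists (U : seq nat -> S -> Prop) (U2 : seq nat -> seq nat -> S -> Prop),
    [/\ family (fun _ => True) L0 F U,
        (forall t, t \in F ->
           family (tilde F U t) (restr_base L1 (tilde F U t)) (lt_V (c t)) (U2 t)) &
        (forall t s x, t \in F -> s \in lt_V (c t) ->
           tilde (lt_V (c t)) (U2 t) s x -> A x = lt_v (c t) s)].

End Levels.

(* Main.v *)
Require Import Defs.
From mathcomp Require Import all_boot.
From mathcomp Require Import boolp.

Set Implicit Arguments. Unset Strict Implicit. Unset Printing Implicit Defensive.

(** Let a deterministic automaton recognise all the sets [A = i], so that [A x]
    depends only on the set of states visited infinitely often by the run on
    [x]. Given a topological family determining [A], saturate it along the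
    automaton: [x] enters the new [U_t] when its run meets a state [q] reached
    by some word whose whole cylinder lies in the old [U_t]; and [x] enters the
    new [U_ts] when its infinity set lies in an infinity set [D] for which some
    word [w] leading into [D] has all its continuations staying in [D] inside
    the old [U_ts]. The saturated sets depend only on the infinity set, hence
    are recognised by the same automaton. The closed set of continuations of
    [w] staying in [D] is a Baire space whose generic points have infinity set
    [D], so a suitable generic point transports the cover and the value of [A]
    from the old family to the new one. *)

(** * Infinity sets of sequences in a finite set *)

Section InfinitySets.
Variable Q : finType.
Implicit Types r : nat -> Q.

Definition infset r : {set Q} := [set q | `[< inf_often r q >]].

Lemma infsetP r q : q \in infset r <-> inf_often r q.
Proof. by rewrite inE; split => /asboolP. Qed.

(** Each state outside the infinity set has a time after which it never occurs; finiteness of [Q]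
    gives a maximum of these times. *)
Lemma infset_eventually r : exists N, forall m, N <= m -> r m \in infset r.
Proof.
have /choice [N NP] : forall q, exists n, forall m, n <= m -> r m = q ->
    q \in infset r.
  move=> q; case: (pselect (inf_often r q)) => [io|].
    by exists 0 => m _ _; apply/infsetP.
  by move=> /existsNP [n nP]; exists n => m nm rm; case: nP; exists m.
exists (\max_q N q) => m Nm; apply: (NP _ m) => //.
exact: leq_trans (leq_bigmax (r m)) Nm.
Qed.

Lemma infset_subset r (D : {set Q}) :
  infset r \subset D <-> exists n, forall m, n <= m -> r m \in D.
Proof.
split=> [/subsetP sD|[n nP]].
  by have [N NP] := infset_eventually r; exists N => m /NP /sD.
by apply/subsetP => q /infsetP /(_ n) [m [nm <-]]; exact: nP.
Qed.

Lemma infset_shift r r' n m :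
  (forall j, r (n + j) = r' (m + j)) -> infset r = infset r'.
Proof.
move=> E; apply/setP => q; apply/idP/idP => /infsetP io; apply/infsetP => N.
  have [i [iN <-]] := io (n + N); exists (m + (i - n)).
  have ni : n <= i := leq_trans (leq_addr _ _) iN.
  rewrite -E subnKC //; split => //.
  by rewrite (leq_trans _ (leq_addl _ _)) // leq_subRL.
have [i [iN <-]] := io (m + N); exists (n + (i - m)).
have ni : m <= i := leq_trans (leq_addr _ _) iN.
rewrite E subnKC //; split => //.
by rewrite (leq_trans _ (leq_addl _ _)) // leq_subRL.
Qed.

End InfinitySets.

(** For the forward inclusion, a visit of [g \o r] to [q] late enough comes from a value of [r]
    already in its infinity set. *)
Lemma infset_comp (Q Q' : finType) (g : Q -> Q') (r : nat -> Q) :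
  infset (g \o r) = g @: infset r.
Proof.
apply/setP => q; apply/idP/imsetP => [/infsetP io|[p /infsetP io ->]].
  have [N NP] := infset_eventually r.
  by have [m [/NP rm <-]] := io N; exists (r m).
by apply/infsetP => n; have [m [nm <-]] := io n; exists m.
Qed.

(** * Languages determined by infinity sets *)

Section Saturated.
Variables (X Q : finType) (f : Q -> X -> Q) (q0 : Q).

Definition saturated (L : (nat -> X) -> Prop) : Prop :=
  forall x y, infset (run f q0 x) = infset (run f q0 y) -> L x -> L y.

(** The table lists the infinity sets of the runs on members of [L]; saturation makes any other word
    with a listed set a member too. *)
Lemma saturated_accepts (L : (nat -> X) -> Prop) : saturated L ->
  exists T : seq {set Q}, forall x, L x <-> muller_accepts f q0 T x.
Proof.
move=> satL; pose acc D := `[< exists2 x, infset (run f q0 x) = D & L x >].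
exists (enum acc) => x; split=> [Lx|[S]].
  exists (infset (run f q0 x)); last exact: infsetP.
  by rewrite mem_enum; apply/asboolP; exists x.
rewrite mem_enum => /asboolP [y yS Ly] SP; apply: satL Ly.
by rewrite yS; apply/setP => q; apply/idP/idP => [/SP|] /infsetP // /SP.
Qed.

Lemma accepts_saturated (L : (nat -> X) -> Prop) (T : seq {set Q}) :
  (forall x, L x <-> muller_accepts f q0 T x) -> saturated L.
Proof.
move=> LT x y exy /LT [S ST SP]; apply/LT; exists S => // q.
by rewrite SP -!infsetP exy.
Qed.

End Saturated.

(** The boolean lets one argument serve both classes: aperiodicity is simply carried along with the
    automaton. *)
Definition automata_class {X : finType} (ap : bool) :
    ((nat -> X) -> Prop) -> Prop :=
  if ap then aperiodic (X:=X) else regular (X:=X).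

(** * Products and common automata *)

Section Product.
Variables (X Q1 Q2 : finType) (f1 : Q1 -> X -> Q1) (f2 : Q2 -> X -> Q2).

Definition prod_step (q : Q1 * Q2) (a : X) := (f1 q.1 a, f2 q.2 a).

Lemma ext_prod q u : ext prod_step q u = (ext f1 q.1 u, ext f2 q.2 u).
Proof. by elim: u q => [[]|a u IH] //= q; rewrite IH. Qed.

Lemma run_prod p x n :
  run prod_step p x n = (run f1 p.1 x n, run f2 p.2 x n).
Proof. by elim: n => [|n /= ->] //; case: p. Qed.

Lemma aperiodic_prod : aperiodic_automaton f1 -> aperiodic_automaton f2 ->
  aperiodic_automaton prod_step.
Proof.
move=> ap1 ap2 [q1 q2] u n u0 n0; rewrite !ext_prod /= => -[e1 e2].
by rewrite (ap1 _ _ n) // (ap2 _ _ n).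
Qed.

Lemma infset_prod1 p x :
  infset (run f1 p.1 x) = fst @: infset (run prod_step p x).
Proof.
rewrite -infset_comp; apply: (@infset_shift _ _ _ 0 0) => j /=.
by rewrite run_prod.
Qed.

Lemma infset_prod2 p x :
  infset (run f2 p.2 x) = snd @: infset (run prod_step p x).
Proof.
rewrite -infset_comp; apply: (@infset_shift _ _ _ 0 0) => j /=.
by rewrite run_prod.
Qed.

Lemma saturated_prod1 p L :
  saturated f1 p.1 L -> saturated prod_step p L.
Proof. by move=> sat x y e; apply: sat; rewrite !infset_prod1 e. Qed.

Lemma saturated_prod2 p L :
  saturated f2 p.2 L -> saturated prod_step p L.
Proof. by move=> sat x y e; apply: sat; rewrite !infset_prod2 e. Qed.

End Product.

Section AutomataClass.
Variables (X : finType) (ap : bool).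

Lemma automata_classP (L : (nat -> X) -> Prop) :
  automata_class ap L <->
  exists (Q : finType) (f : Q -> X -> Q) (q0 : Q),
    (ap -> aperiodic_automaton f) /\ saturated f q0 L.
Proof.
rewrite /automata_class; case: ap; split.
- by move=> [Q [f [q0 [T [fap /accepts_saturated]]]]]; exists Q, f, q0.
- move=> [Q [f [q0 [/(_ isT) fap /saturated_accepts [T LT]]]]].
  by exists Q, f, q0, T.
- by move=> [Q [f [q0 [T /accepts_saturated]]]]; exists Q, f, q0.
- by move=> [Q [f [q0 [_ /saturated_accepts [T LT]]]]]; exists Q, f, q0, T.
Qed.

(** An iterated product, started from the one-state automaton; each factor's infinity set is a
    projection of that of the product. *)
Lemma common_automaton (I : eqType) (s : seq I) (L : I -> (nat -> X) -> Prop) :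
  (forall i, i \in s -> automata_class ap (L i)) ->
  exists (Q : finType) (f : Q -> X -> Q) (q0 : Q),
    (ap -> aperiodic_automaton f) /\ forall i, i \in s -> saturated f q0 (L i).
Proof.
elim: s => [|i s IH] Ls.
  exists unit, (fun q _ => q), tt; split=> // _ q u n _ _ _.
  by case: (ext _ _ _); case: q.
have [|Q2 [f2 [q2 [ap2 sat2]]]] := IH.
  by move=> j js; apply: Ls; rewrite inE js orbT.
have /automata_classP [Q1 [f1 [q1 [ap1 sat1]]]] := Ls i (mem_head _ _).
exists (Q1 * Q2)%type, (prod_step f1 f2), (q1, q2); split.
  by move=> a; apply: aperiodic_prod; auto.
move=> j; rewrite inE => /predU1P [->|js]; first exact: saturated_prod1.
by apply: saturated_prod2; exact: sat2.
Qed.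

End AutomataClass.

(** * Maximal nodes of a family *)

Section MaximalNode.
Variables (S : Type) (W : seq (seq nat)) (U : seq nat -> S -> Prop).

(** Climbing to a child whose set contains [x] must stop, since lengths of strings in the finite [W]
    are bounded. *)
Lemma in_some_tilde t x : t \in W -> U t x ->
  exists2 t', t' \in W & tilde W U t' x.
Proof.
pose h := \max_(u <- W) size u.
have [n] := ubnP (h - size t); elim: n t => // n IH t tn tW Ux.
have [[i [iW Ui]]|no] := pselect (exists i, rcons t i \in W /\ U (rcons t i) x);
  last by exists t.
apply: (IH (rcons t i)) => //; rewrite size_rcons.
have : size (rcons t i) <= h by apply: leq_bigmax_seq.
rewrite size_rcons => th; apply: leq_trans (_ : h - size t <= n) => //.
by rewrite ltn_sub2l.
Qed.

End MaximalNode.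

(** * Cylinders, spliced words and confined runs *)

Section Cylinders.
Variable X : finType.
Implicit Types x y z : nat -> X.

Definition agree n x y := forall i, i < n -> y i = x i.

Lemma agree_trans n m x y z : n <= m -> agree n x y -> agree m y z -> agree n x z.
Proof. by move=> nm xy yz i ij; rewrite yz ?xy // (leq_trans ij). Qed.

Lemma sigma02_bigcup (I : countType) (C : I -> (nat -> X) -> Prop) :
  (forall i, cantor_closed (C i)) -> sigma02 (fun x => exists i, C i x).
Proof.
move=> clC.
(* Numbers coding no index contribute the empty set, which is closed. *)
exists (fun n x => if unpickle n is Some i then C i x else False); split.
  by move=> n; case: unpickle => [i|]; [exact: clC|exists 0].
move=> x; split=> [[i Cix]|[n]]; first by exists (pickle i); rewrite pickleK.
by case: unpickle => // i; exists i.
Qed.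

End Cylinders.

Section Runs.
Variables (X Q : finType) (f : Q -> X -> Q) (q0 : Q).
Implicit Types (x y z : nat -> X) (D : {set Q}).
Local Notation run := (run f q0).

Lemma run_agree n x y : agree n x y -> forall m, m <= n -> run y m = run x m.
Proof.
by move=> xy; elim=> [|m IH] //= mn; rewrite IH ?xy // ltnW.
Qed.

Definition splice x n y m : nat -> X :=
  fun i => if i < n then x i else y (m + (i - n)).

Lemma agree_splice x n y m : agree n x (splice x n y m).
Proof. by move=> i; rewrite /splice => ->. Qed.

Lemma run_splice x n y m : run x n = run y m ->
  forall j, run (splice x n y m) (n + j) = run y (m + j).
Proof.
move=> e; elim=> [|j IH].
  by rewrite !addn0 -e (run_agree (@agree_splice x n y m)).
rewrite !addnS /= IH /splice ltnNge leq_addr /=.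
by rewrite addKn.
Qed.

(** For fixed [D], these sets of [y] serve as basic neighbourhoods in the closed space of words
    whose runs are confined to [D] from some fixed time on. *)
Definition stay D x n y := agree n x y /\ forall m, n <= m -> run y m \in D.

Lemma stay_refl D x n : (forall m, n <= m -> run x m \in D) -> stay D x n x.
Proof. by []. Qed.

Lemma stay_trans D x n y m z : n <= m -> stay D x n y -> stay D y m z ->
  stay D x n z.
Proof.
move=> nm [xy yD] [yz zD]; split; first exact: agree_trans xy yz.
move=> i ni; case: (leqP m i) => [/zD //|im].
by rewrite (run_agree yz) ?(ltnW im) //; exact: yD.
Qed.

(** A run with infinity set [D] passes through [run x n] after settling in [D]; that tail is
    appended to the first [n] letters of [x]. *)
Lemma continuation x n D : (exists z, infset (run z) = D) -> run x n \in D ->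
  exists2 y, stay D x n y & infset (run y) = D.
Proof.
move=> [z zD] xD; have [N NP] := infset_eventually (run z).
have /infsetP /(_ N) [m [Nm zm]] : run x n \in infset (run z) by rewrite zD.
have E := run_splice (esym zm).
exists (splice x n z m); last by rewrite (infset_shift E).
split=> [|i ni]; first exact: agree_splice.
by rewrite -(subnKC ni) E -zD NP // (leq_trans Nm) // leq_addr.
Qed.

(** * Baire category for confined runs *)

Section Baire.
Variables (D : {set Q}) (x0 : nat -> X) (n0 : nat).
Hypothesis x0D : stay D x0 n0 x0.

(** The hypothesis says that each [O j] contains a cylinder near every point of the space. Stages
    are pairs of a point and the length of the prefix fixed so far; the desired point is their
    limit. *)
Lemma baire_nat (O : nat -> (nat -> X) -> Prop) :
  (forall j x n, n0 <= n -> stay D x0 n0 x -> exists y m,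
     stay D x n y /\ forall z, agree m y z -> O j z) ->
  exists2 y, stay D x0 n0 y & forall j, O j y.
Proof.
move=> dense.
pose good (p : (nat -> X) * nat) := n0 <= p.2 /\ stay D x0 n0 p.1.
pose step j (p p' : (nat -> X) * nat) := good p -> [/\ good p', p.2 < p'.2,
  agree p.2 p.1 p'.1 & forall z, agree p'.2 p'.1 z -> O j z].
have /choice [g gP] : forall jp, exists p', step jp.1 jp.2 p'.
  move=> [j [x n]]; case: (pselect (good (x, n))) => [[/= n0n xD]|ng];
    last by exists (x, n).
  have [y [m [xy Oy]]] := dense j x n n0n xD.
  (* Length above [n] makes the cylinders shrink to one point; length at least [m] places the new
     cylinder inside [O j]. *)
  exists (y, maxn n.+1 m) => _ /=; split; rewrite ?leq_maxl //.
  - split; last exact: stay_trans xD xy.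
    by rewrite /= leq_max (leq_trans n0n (leqnSn n)).
  - by case: xy.
  - by move=> z yz; apply: Oy => i im; apply: yz; rewrite leq_max im orbT.
pose s := fix s j := if j is j'.+1 then g (j', s j') else (x0, n0).
have sgood j : good (s j).
  by elim: j => [|j IH]; [split|have [] := gP (j, s j) IH].
have sS j := gP (j, s j) (sgood j).
have slt j : j <= (s j).2.
  by elim: j => [|j IH] //; apply: leq_ltn_trans IH _; case: (sS j).
have smono j i : (s j).2 <= (s (j + i)).2 /\ agree (s j).2 (s j).1 (s (j + i)).1.
  elim: i => [|i [le ag]]; first by rewrite addn0.
  rewrite addnS; have [_ lt ag' _] := sS (j + i); split.
    by rewrite (leq_trans le) // ltnW.
  exact: agree_trans ag ag'.
(* Stage [i.+1] fixes at least [i.+1] letters, so its letter at [i] is final. *)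
pose y i := (s i.+1).1 i.
have yP j : agree (s j).2 (s j).1 y.
  move=> i ij; rewrite /y; case: (leqP j i.+1) => [le|/ltnW le].
    by rewrite -(subnKC le); have [_ ->] := smono j (i.+1 - j).
  by rewrite -[in RHS](subnKC le); have [_ ->] := smono i.+1 (j - i.+1).
exists y; last by move=> j; have [_ _ _] := sS j; apply; exact: (yP j.+1).
split=> [|m n0m]; first exact: (yP 0).
(* Stage [m] fixes the first [m] letters, hence the state at time [m], and its point stays in
   [D]. *)
rewrite (run_agree (yP m) (slt m)).
by have [_ [_ ->]] := sgood m.
Qed.

Lemma baire (I : countType) (O : I -> (nat -> X) -> Prop) :
  (forall i x n, n0 <= n -> stay D x0 n0 x -> exists y m,
     stay D x n y /\ forall z, agree m y z -> O i z) ->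
  exists2 y, stay D x0 n0 y & forall i, O i y.
Proof.
move=> dense.
have [|y yD yO] :=
    @baire_nat (fun j z => if unpickle j is Some i then O i z else True).
  move=> j x n n0n xD; case: unpickle => [i|]; first exact: dense.
  exists x, 0; split=> //; apply: stay_refl => m nm.
  by case: xD => _; apply; exact: leq_trans nm.
by exists y => // i; have := yO (pickle i); rewrite pickleK.
Qed.

(** Each [B i] is a countable union of closed sets and contains no basic neighbourhood, so it is
    meagre. Visiting a given state of [D] after a given time is an open dense condition, by
    [continuation]. *)
Lemma generic_run (I : countType) (P : I -> Prop) (B : I -> (nat -> X) -> Prop) :
  (exists z, infset (run z) = D) ->
  (forall i, P i -> sigma02 (B i)) ->
  (forall i x n, P i -> n0 <= n -> stay D x0 n0 x ->
     ~ (forall y, stay D x n y -> B i y)) ->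
  exists y, [/\ stay D x0 n0 y, infset (run y) = D & forall i, P i -> ~ B i y].
Proof.
move=> loopD sB denseB.
have /choice [C CP] : forall i, exists C : nat -> (nat -> X) -> Prop, P i ->
    (forall n, cantor_closed (C n)) /\ forall x, B i x <-> exists n, C n x.
  move=> i; case: (pselect (P i)) => [/sB [C CP]|nP]; first by exists C.
  by exists (fun _ _ => True).
(* Left indices ask to avoid one closed piece of some [B i], right ones to visit [q] at time [m] or
   later. *)
pose O (i : I * nat + Q * nat) z := match i with
  | inl (i, j) => P i -> ~ C i j z
  | inr (q, m) => q \in D -> exists n, m <= n /\ run z n = q
  end.
have [|y yD yO] := @baire _ O.
  move=> [[i j]|[q m]] x n n0n xD /=.
    have xx : stay D x n x.
      by apply: stay_refl => l nl; case: xD => _; apply; exact: leq_trans nl.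
    case: (pselect (P i)) => [Pi|nP]; last by exists x, 0.
    have [clC BC] := CP i Pi.
    have /existsNP [y /not_implyP [xy nBy]] := denseB i x n Pi n0n xD.
    have [|l lP] := clC j y; first by move=> Cy; case: nBy; apply/BC; exists j.
    by exists y, l; split=> // z /lP.
  have [y xy yD] := @continuation x n D loopD (xD.2 n n0n).
  case: (boolP (q \in D)) => [qD|nq]; last by exists y, 0.
  have /infsetP /(_ m) [l [ml yl]] : q \in infset (run y) by rewrite yD.
  exists y, l; split=> // z yz _; exists l; split=> //.
  by rewrite (run_agree yz).
exists y; split=> //.
  apply/eqP; rewrite eqEsubset; apply/andP; split.
    by apply/infset_subset; exists n0; exact: yD.2.
  by apply/subsetP => q qD; apply/infsetP => m; exact: (yO (inr (q, m))).
move=> i Pi /((CP i Pi).2) [j Cj].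
exact: (yO (inl (i, j)) Pi Cj).
Qed.

End Baire.
End Runs.

(** * Open and sigma hulls along an automaton *)

Section Saturation.
Variables (X Q : finType) (f : Q -> X -> Q) (q0 : Q).
Implicit Types (x y z : nat -> X) (D : {set Q}) (Y : (nat -> X) -> Prop).
Local Notation run := (run f q0).
Local Notation stay := (stay f q0).

Definition forces Y (q : Q) : Prop :=
  exists x n, run x n = q /\ forall y, agree n x y -> Y y.

Definition open_hull Y x : Prop := exists n, forces Y (run x n).

Lemma forces_mono Y Y' q : (forall x, Y x -> Y' x) -> forces Y q -> forces Y' q.
Proof. by move=> YY' [x [n [xq xY]]]; exists x, n; split=> // y /xY /YY'. Qed.

(** The forcing word is followed by the letters of [x] from [n] to [m]; this reaches [run x m] and
    only shrinks the cylinder. *)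
Lemma forces_later Y x n m : n <= m -> forces Y (run x n) -> forces Y (run x m).
Proof.
move=> nm [w [l [wl wY]]]; exists (splice w l x n), (l + (m - n)); split.
  by rewrite (run_splice wl) subnKC.
move=> y wy; apply: wY; apply: agree_trans wy; first exact: leq_addr.
exact: agree_splice.
Qed.

Lemma forces_open Y x N : cantor_open Y -> Y x ->
  exists2 m, N <= m & forces Y (run x m).
Proof.
move=> oY Yx; have [n nP] := oY x Yx; exists (maxn N n); first exact: leq_maxl.
exists x, (maxn N n); split=> // y xy; apply: nP => i lt; apply: xy.
by rewrite leq_max lt orbT.
Qed.

(** Forcing persists along a run, so a forcing state can be sought among those visited infinitely
    often. *)
Lemma open_hullP Y x :
  open_hull Y x <-> exists2 q, q \in infset (run x) & forces Y q.
Proof.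
split=> [[n nY]|[q /infsetP /(_ 0) [n [_ <-]] qY]]; last by exists n.
have [N NP] := infset_eventually (run x).
exists (run x (maxn N n)); first by rewrite NP // leq_maxl.
by apply: forces_later nY; exact: leq_maxr.
Qed.

Lemma open_hull_saturated Y : saturated f q0 (open_hull Y).
Proof. by move=> x y e /open_hullP; rewrite e => /open_hullP. Qed.

Lemma open_hull_open Y : cantor_open (open_hull Y).
Proof.
move=> x [n nY]; exists n => y xy; exists n.
by rewrite (run_agree f q0 xy).
Qed.

(** [Y] contains a basic neighbourhood in a space of runs confined to [D]. That [D] is the infinity
    set of some run makes this neighbourhood nonempty. *)
Definition stay_forces Y D : Prop :=
  (exists z, infset (run z) = D) /\
  exists x n, run x n \in D /\ forall y, stay D x n y -> Y y.

Definition sigma_hull Y x : Prop :=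
  exists2 D, stay_forces Y D & infset (run x) \subset D.

Lemma stay_forces_mono Y Y' D : (forall x, Y x -> Y' x) ->
  stay_forces Y D -> stay_forces Y' D.
Proof.
move=> YY' [lD [x [n [xD xY]]]]; split=> //.
by exists x, n; split=> // y /xY /YY'.
Qed.

Lemma sigma_hull_saturated Y : saturated f q0 (sigma_hull Y).
Proof. by move=> x y e [D DY xD]; exists D; rewrite -?e. Qed.

Lemma sigma_hull_sigma02 Y : sigma02 (sigma_hull Y).
Proof.
(* Confinement to [D] from time [n] on is a closed condition, and there are countably many pairs of
   [D] and [n]. *)
pose C (p : {set Q} * nat) x := stay_forces Y p.1 /\
  forall m, p.2 <= m -> run x m \in p.1.
have [|C' [clC' C'P]] := @sigma02_bigcup X _ C.
  move=> [D n] x; rewrite /C /= => nC.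
  case: (pselect (stay_forces Y D)) => [DY|nD]; last by exists 0 => y _ [].
  have /existsNP [m /not_implyP [nm xm]] :
    ~ forall m, n <= m -> run x m \in D by move=> h; apply: nC.
  exists m => y xy [_ /(_ m nm)].
  by rewrite (run_agree f q0 xy).
exists C'; split=> // x; rewrite -C'P; split.
  by move=> [D DY /infset_subset [n nP]]; exists (D, n).
by move=> [[D n] [DY nP]]; exists D => //; apply/infset_subset; exists n.
Qed.

(** Forcing within a larger [D] passes down to the infinity set of [x]: the forcing word is
    prolonged inside [D] to a state of the settled run on [x], after which continuations stay in the
    smaller set. *)
Lemma sigma_hull_forces Y x :
  sigma_hull Y x <-> stay_forces Y (infset (run x)).
Proof.
split=> [|xY]; last by exists (infset (run x)).
move=> [D [lD [w [n [wD wY]]]] xD]; split; first by exists x.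
have [y wy yD] := continuation lD wD.
have [N NP] := infset_eventually (run x).
have /infsetP /(_ n) [m [nm ym]] : run x N \in infset (run y).
  by rewrite yD (subsetP xD) // NP.
exists y, m; split=> [|z yz]; first by rewrite ym NP.
apply: wY; apply: (stay_trans nm wy).
by case: yz => yz zD; split=> // i mi; apply: (subsetP xD); exact: zD.
Qed.

End Saturation.

(** * Transfer of a family to its hulls *)

Section Transfer.
Variables (X Q : finType) (f : Q -> X -> Q) (q0 : Q) (k : nat).
Variables (F : seq (seq nat)) (c : seq nat -> ltree k) (A : (nat -> X) -> 'I_k).
Variables (U : seq nat -> (nat -> X) -> Prop)
  (U2 : seq nat -> seq nat -> (nat -> X) -> Prop).
Hypothesis famU : Defs.family (fun _ => True) (@cantor_open X) F U.
Hypothesis famU2 : forall t, t \in F ->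
  Defs.family (tilde F U t) (restr_base (@sigma02 X) (tilde F U t))
    (lt_V (c t)) (U2 t).
Hypothesis detA : forall t s x, t \in F -> s \in lt_V (c t) ->
  tilde (lt_V (c t)) (U2 t) s x -> A x = lt_v (c t) s.
Hypothesis satA : forall i, saturated f q0 (fun x => A x = i).
Local Notation run := (run f q0).
Local Notation stay := (stay f q0).

Definition hull1 t := open_hull f q0 (U t).

(** Intersecting with the new component puts each set in its restricted base. *)
Definition hull2 t s x :=
  tilde F hull1 t x /\ sigma_hull f q0 (U2 t s) x.

Lemma hull1_family (L : ((nat -> X) -> Prop) -> Prop) :
  (forall t, L (hull1 t)) -> Defs.family (fun _ => True) L F hull1.
Proof.
have [oU mU cU] := famU => LU; split=> // [t i x tF iF [n nU]|x].
  by exists n; apply: forces_mono nU => y; exact: mU.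
split=> // _; have [t [tF Ux]] := (cU x).1 I; exists t; split=> //.
by have [m _ mP] := forces_open f q0 0 (oU t tF) Ux; exists m.
Qed.

(** If [y] entered a child's open set, a prefix of length at least [n] would force it at a state
    visited infinitely often on [x], placing [x] in the child's hull. *)
Lemma stay_tilde t x w n : t \in F -> tilde F hull1 t x ->
  (forall y, agree n w y -> U t y) ->
  forall y, stay (infset (run x)) w n y -> tilde F U t y.
Proof.
have [oU _ _] := famU => tF [_ xno] wU y [wy yD]; split; first exact: wU.
move=> [i [iF Uy]]; apply: xno; exists i; split=> //.
have [m nm mP] := forces_open f q0 n (oU _ iF) Uy.
by apply/open_hullP; exists (run y m) => //; exact: yD.
Qed.

(** If [x] were in no new set, no old [U2 t s] would contain a neighbourhood of confined runs; a
    generic point would then avoid them all while lying in the old component they cover. *)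
Lemma hull2_cover t x : t \in F -> tilde F hull1 t x ->
  exists2 s, s \in lt_V (c t) & hull2 t s x.
Proof.
move=> tF xt; have [bU2 _ cU2] := famU2 tF.
set D := infset (run x).
have [/open_hullP [q qD [w [n [wq wU]]]] _] := xt.
have lD : exists z, infset (run z) = D by exists x.
have [x0 wx0 _] : exists2 y, stay D w n y & infset (run y) = D.
  by apply: continuation => //; rewrite wq.
have x0x0 : stay D x0 n x0 by apply: stay_refl => m /wx0.2.
have sub y : stay D x0 n y -> tilde F U t y.
  by move=> x0y; apply: stay_tilde tF xt wU _ (stay_trans (leqnn n) wx0 x0y).
have /choice [B BP] : forall s, exists B, s \in lt_V (c t) ->
    sigma02 B /\ forall x, U2 t s x <-> tilde F U t x /\ B x.
  move=> s; case: (boolP (s \in lt_V (c t))) => [/bU2 [B BP]|_].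
    by exists B.
  by exists (fun _ => True).
apply: contrapT => no.
have [||y [yD _ yB]] :=
    generic_run x0x0 (P := fun s => is_true (s \in lt_V (c t))) (B := B) lD.
- by move=> s /BP [].
- move=> s y m sV nm x0y yB; apply: no; exists s => //; split=> //.
  apply/sigma_hull_forces; split=> //; exists y, m; split; first exact: x0y.2.
  move=> z yz; apply/(BP s sV).2; split; last exact: yB.
  by apply: sub; exact: stay_trans yz.
have [s [sV U2y]] := (cU2 y).1 (sub _ yD).
by apply: (yB s sV); have [_ /(_ y) [/(_ U2y) []]] := BP s sV.
Qed.

Lemma hull2_family (L : ((nat -> X) -> Prop) -> Prop) t : t \in F ->
  (forall s, L (sigma_hull f q0 (U2 t s))) ->
  Defs.family (tilde F hull1 t) (restr_base L (tilde F hull1 t))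
    (lt_V (c t)) (hull2 t).
Proof.
move=> tF LU; have [_ mU2 _] := famU2 tF; split.
- by move=> s sV; exists (sigma_hull f q0 (U2 t s)).
- move=> s i x sV iV [xt [D DU xD]]; split=> //; exists D => //.
  by apply: stay_forces_mono DU => y; exact: mU2.
- move=> x; split=> [/(hull2_cover tF) [s sV xs]|[s [_ []]]] //.
  by exists s.
Qed.

(** As [x] lies in no child's hull, the old children's sets contain no neighbourhood, and a generic
    point of the neighbourhood inside [U2 t s] avoids them. *)
Lemma hull2_determines t s x : t \in F -> s \in lt_V (c t) ->
  tilde (lt_V (c t)) (hull2 t) s x -> A x = lt_v (c t) s.
Proof.
move=> tF sV [[xt /sigma_hull_forces [lD [w [n [wD wU]]]]] xno].
have [bU2 mU2 cU2] := famU2 tF.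
set D := infset (run x) in lD wD wU.
have [x0 wx0 _] := continuation lD wD.
have x0x0 : stay D x0 n x0 by apply: stay_refl => m /wx0.2.
have sub y : stay D x0 n y -> U2 t s y.
  by move=> x0y; exact: wU (stay_trans (leqnn n) wx0 x0y).
have /choice [B BP] : forall i, exists B, rcons s i \in lt_V (c t) ->
    sigma02 B /\ forall x, U2 t (rcons s i) x <-> tilde F U t x /\ B x.
  move=> i; case: (boolP (rcons s i \in lt_V (c t))) => [/bU2 [B BP]|_].
    by exists B.
  by exists (fun _ => True).
have [||y [yD yinf yB]] :=
    generic_run x0x0 (P := fun i => rcons s i \in lt_V (c t)) (B := B) lD.
- by move=> i /BP [].
- move=> i y m iV nm x0y yB; apply: xno; exists i; split=> //; split=> //.
  apply/sigma_hull_forces; split=> //; exists y, m; split; first exact: x0y.2.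
  move=> z yz; apply/(BP i iV).2; split; last exact: yB.
  by apply/cU2; exists s; split=> //; apply: sub; exact: stay_trans yz.
(* The old family gives [A y] this label, and [y] has the infinity set of [x], so [A x] is the
   same. *)
apply: (@satA (lt_v (c t) s) y x yinf); apply: (detA tF sV); split; first exact: sub.
move=> [i [iV U2y]]; apply: (yB i iV).
by have [_ /(_ y) [/(_ U2y) []]] := BP i iV.
Qed.

End Transfer.

(** * Comparison of the levels *)

Lemma level_mono (S : Type) (L0 L1 M0 M1 : (S -> Prop) -> Prop) (k : nat)
    (F : seq (seq nat)) (c : seq nat -> ltree k) (A : S -> 'I_k) :
  (forall Y, L0 Y -> M0 Y) -> (forall Y, L1 Y -> M1 Y) ->
  level L0 L1 F c A -> level M0 M1 F c A.
Proof.
move=> LM0 LM1 [U [U2 [[bU mU cU] famU2 detA]]]; exists U, U2; split=> //.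
  by split=> // t /bU /LM0.
move=> t tF; have [bU2 mU2 cU2] := famU2 t tF; split=> // s /bU2 [B [LB BP]].
by exists B; split=> //; exact: LM1.
Qed.

(** A product automaton for all [U t] and all base sets cutting out the [U2 t s] determines [A]:
    words with equal infinity sets lie in the same components. *)
Lemma level_in_Bk (X : finType) (ap : bool) (k : nat)
    (F : seq (seq nat)) (c : seq nat -> ltree k) (A : (nat -> X) -> 'I_k) :
  level (@automata_class X ap) (automata_class ap) F c A ->
  in_Bk (automata_class ap) A.
Proof.
move=> [U [U2 [[bU _ cU] famU2 detA]]] i.
have /choice [B BP] : forall ts : seq nat * seq nat, exists B,
    ts.1 \in F -> ts.2 \in lt_V (c ts.1) -> automata_class ap B /\
    forall x, U2 ts.1 ts.2 x <-> tilde F U ts.1 x /\ B x.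
  move=> [t s] /=; case: (boolP (t \in F)) => tF; last by exists (fun _ => True).
  case: (boolP (s \in lt_V (c t))) => sV; last by exists (fun _ => True).
  by have [/(_ s sV) [B BP] _ _] := famU2 t tF; exists B.
have [|Q1 [f1 [q1 [ap1 sat1]]]] := @common_automaton X ap _ F U; first exact: bU.
have [|Q2 [f2 [q2 [ap2 sat2]]]] :=
    @common_automaton X ap _ [seq (t, s) | t <- F, s <- lt_V (c t)] B.
  by move=> [_ _] /allpairsPdep [t [s [tF sV [-> ->]]]]; case: (BP (t, s)).
apply/automata_classP; exists (Q1 * Q2)%type, (prod_step f1 f2), (q1, q2).
split=> [a|x y exy Ax]; first by apply: aperiodic_prod; auto.
have UE t z z' : infset (run (prod_step f1 f2) (q1, q2) z) =
    infset (run (prod_step f1 f2) (q1, q2) z') -> t \in F -> U t z -> U t z'.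
  by move=> e tF; apply: saturated_prod1 e; exact: sat1.
have BE t s z z' : infset (run (prod_step f1 f2) (q1, q2) z) =
    infset (run (prod_step f1 f2) (q1, q2) z') -> t \in F ->
    s \in lt_V (c t) -> B (t, s) z -> B (t, s) z'.
  move=> e tF sV; apply: saturated_prod2 e; apply: sat2.
  by apply/allpairsPdep; exists t, s.
have tildeE t z z' : infset (run (prod_step f1 f2) (q1, q2) z) =
    infset (run (prod_step f1 f2) (q1, q2) z') -> t \in F ->
    tilde F U t z -> tilde F U t z'.
  move=> e tF [Uz no]; split; first exact: UE Uz.
  move=> [j [jF Uj]]; apply: no; exists j; split=> //.
  by apply: UE Uj.
have U2E t s z z' : infset (run (prod_step f1 f2) (q1, q2) z) =
    infset (run (prod_step f1 f2) (q1, q2) z') -> t \in F ->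
    s \in lt_V (c t) -> U2 t s z -> U2 t s z'.
  move=> e tF sV; have [_ U2P] := BP (t, s) tF sV.
  move=> /U2P [tz Bz]; apply/U2P; split; first exact: tildeE tz.
  exact: BE Bz.
(* Maximal nodes on both levels locate a component of [x], which [y] shares. *)
have [t0 [t0F U0]] := (cU x).1 I.
have [t tF xt] := in_some_tilde t0F U0.
have [_ _ cU2] := famU2 t tF.
have [s0 [s0V U20]] := (cU2 x).1 xt.
have [s sV [U2x no]] := in_some_tilde s0V U20.
rewrite -Ax (detA t s x) // (detA t s y) //; split; first exact: U2E U2x.
by move=> [j [jV U2j]]; apply: no; exists j; split=> //; apply: U2E U2j.
Qed.

(** Forward, both claims follow by enlarging the bases. Backward, the hulls along a common automaton
    of the sets [A = i] are recognised by that automaton. *)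
Lemma automata_level (X : finType) (ap : bool) (k : nat)
    (F : seq (seq nat)) (c : seq nat -> ltree k) (A : (nat -> X) -> 'I_k) :
  level (fun U => automata_class ap U /\ cantor_open U)
        (fun U => automata_class ap U /\ sigma02 U) F c A <->
  (in_Bk (automata_class ap) A /\ level (@cantor_open X) (@sigma02 X) F c A).
Proof.
split=> [lA|[BA [U [U2 [famU famU2 detA]]]]].
  by split; [apply: (@level_in_Bk _ _ _ F c)|]; apply: level_mono lA => Y [].
have [|Q [f [q0 [apf satA]]]] :=
    @common_automaton X ap _ (enum 'I_k) (fun i x => A x = i).
  by move=> i _; exact: BA.
have {}satA i : saturated f q0 (fun x => A x = i).
  by apply: satA; rewrite mem_enum.
exists (hull1 f q0 U), (hull2 f q0 F U U2); split.
- apply: hull1_family => // t; split; last exact: open_hull_open.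
  apply/automata_classP; exists Q, f, q0; split=> //.
  exact: open_hull_saturated.
- move=> t tF; apply: hull2_family => // s; split; last exact: sigma_hull_sigma02.
  apply/automata_classP; exists Q, f, q0; split=> //.
  exact: sigma_hull_saturated.
- by move=> t s x; exact: hull2_determines.
Qed.

Theorem theorem4p14 (X : finType) (k : nat)
    (B : ((nat -> X) -> Prop) -> Prop)
    (F : seq (seq nat)) (c : seq nat -> ltree k) :
  1 < #|X| -> 1 < k ->
  (B = regular (X:=X) \/ B = aperiodic (X:=X)) ->
  forest_of_trees F c ->
  forall A : (nat -> X) -> 'I_k,
    level (fun U => B U /\ cantor_open U) (fun U => B U /\ sigma02 U) F c A <->
    (in_Bk B A /\ level (@cantor_open X) (@sigma02 X) F c A).
Proof.
move=> _ _ [->|->] _ A; first exact: (@automata_level X false).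
exact: (@automata_level X true).
Qed.
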